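(* Let $k\ge 2$ and $n>2^k$ be integers and put $c=2^k-2$. Let $h,w$ be the positive integers such that $$h(n-1)-wc=\begin{cases}1 & \text{if } \gcd(c,n-1)=1,\\ 0 & \text{otherwise,}\end{cases}$$ with $0<w\le n-2$ minimal. Then the value of the search game on the path $\{0,\dots,n-1\}$ with budget $k$, i.e. $$\max_{x\in\Delta_k}\ \min_{v\in V}\ \sum_{T\in\mathcal{T}_k:\, v\in C(T)} x_T \;=\; \min_{y\in\Delta_V}\ \max_{T\in\mathcal{T}_k}\ \sum_{v\in C(T)} y_v,$$ equals $\frac{h}{w}$. Moreover, the output $x$ of the Greedy Algorithm is an optimal strategy for the seeker; if $\gcd(c,n-1)=d>1$ the hider strategy $y^{\mathrm{nc}}$ is an optimal strategy for the hider, and if $\gcd(c,n-1)=1$ the hider strategy $y^{\mathrm{cp}}$ is an optimal strategy for the hider.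
   Context: Let $G$ be the path graph with vertex set $V=\{0,1,\dots,n-1\}$ and edges $\{v,v+1\}$, $0\le v\le n-2$. A search strategy for a tree $H$ is a rooted binary tree $T$ defined recursively: a single node is a search strategy for any tree $H$; otherwise the root $\rho$ is labeled with an edge $e(\rho)=uv$ of $H$ and has two children whose subtrees are search strategies for the components $H_u,H_v$ of $H-e(\rho)$ containing $u$ and $v$. Each node $\nu$ of $T$ gets a vertex set $V(\nu)$: the root gets $V(H)$, and if the root is labeled $uv$ its two children get $V(H_u)$ and $V(H_v)$, recursively. A vertex $v$ is covered by $T$ if $V(\lambda)=\{v\}$ for some leaf $\lambda$; $C(T)$ is the set of covered vertices. The height of $T$ is the maximal number of edges on a root-to-leaf path; $\mathcal{T}_k$ is the set of search strategies for $G$ of height at most $k$. $\Delta_k$ is the set of probability distributions $x=(x_T)_{T\in\mathcal{T}_k}$ and $\Delta_V$ the set of probability distributions $y=(y_v)_{v\in V}$. Intervals: for integers $u$, $\ell$ and $r\ge1$, $[u\oplus\ell]_r=\{w \bmod r: u\le w\le u+\ell-1\}$ (empty if $\ell\le 0$); the subscript is omitted when $r=n$. For every $v\in V\setminus\{1\}$ there is a strategy $T_v\in\mathcal{T}_k$ with $C(T_v)=[v\oplus(c+1)]$ if $\{0,n-1\}\cap[v\oplus(c+1)]\neq\emptyset$ and $C(T_v)=[v\oplus c]$ otherwise; fix such $T_v$. Greedy Algorithm: set $v=c+1$ and $\mathcal{X}=\{T_0\}$; while $v\notin\{0,1\}$: add $T_v$ to $\mathcal{X}$ and set $v=(v+c)\bmod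 (n-1)$. Output $x_T=1/|\mathcal{X}|$ for $T\in\mathcal{X}$ and $x_T=0$ otherwise. Hider strategy $y^{\mathrm{nc}}$ (case $d=\gcd(c,n-1)>1$, $w=(n-1)/d$): $y_v=0$ if $v$ is a multiple of $d$ and $y_v=\frac{1}{w(d-1)}$ otherwise. Hider strategy $y^{\mathrm{cp}}$ (case $\gcd(c,n-1)=1$): let $g(v)=v\frac{h}{wc}$ and $r=\lfloor c/h\rfloor$. Set $y_0=y_{n-1}=0$. Starting at $v=1$, repeatedly: choose the largest $r^*\in\{r,r+1\}$ with $g(v+r^*-1)\le \sum_{i=1}^{v-1}y_i+\frac1w$, set $y_i=\frac{1}{r^*w}$ for $i\in\{v,\dots,v+r^*-1\}$ (this block is called a segment), and replace $v$ by $v+r^*$; stop once $v>n-2$. *)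

(* Defs.v *)
From HB Require Import structures.
From mathcomp Require Import all_boot all_order all_algebra.
Set Implicit Arguments. Unset Strict Implicit. Unset Printing Implicit Defensive.
Import Order.TTheory GRing.Theory Num.Theory.

(* Search strategies on (sub)paths of the path graph 0 - 1 - ... - (n-1).
   A node [Node e l r] is labeled with the edge {e, e+1}; the left child is a
   strategy for the component containing e (lower part), the right child for
   the component containing e+1 (upper part). *)
Inductive tree : Type := Leaf | Node of nat & tree & tree.

Fixpoint tree_eqb (s t : tree) : bool :=
  match s, t with
  | Leaf, Leaf => true
  | Node e l r, Node e' l' r' => (e == e') && tree_eqb l l' && tree_eqb r r'
  | _, _ => false
  end.

Lemma tree_eqP : Equality.axiom tree_eqb.
Proof.
elim=> [|e l IHl r IHr] [|e' l' r'] /=; try by constructor.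
case: eqP => [<-|ne]; last by constructor; case.
case: IHl => [<-|ne]; last by constructor; case.
case: IHr => [<-|ne]; last by constructor; case.
by constructor.
Qed.

HB.instance Definition _ := hasDecEq.Build tree tree_eqP.

Fixpoint valid (a b : nat) (T : tree) : bool :=
  match T with
  | Leaf => true
  | Node e l r => (a <= e) && (e < b) && valid a e l && valid e.+1 b r
  end.

Fixpoint height (T : tree) : nat :=
  match T with
  | Leaf => 0
  | Node _ l r => (maxn (height l) (height r)).+1
  end.

Fixpoint cov (a b : nat) (T : tree) (v : nat) : bool :=
  match T with
  | Leaf => (a == b) && (v == a)
  | Node e l r => cov a e l v || cov e.+1 b r v
  end.

Definition covers (n : nat) (T : tree) (v : nat) : bool := cov 0 n.-1 T v.

Definition in_Tk (n k : nat) (T : tree) : bool := valid 0 n.-1 T && (height T <= k).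

Definition cpar (k : nat) : nat := 2 ^ k - 2.

Definition delta (k n : nat) : nat := if gcdn (cpar k) n.-1 == 1 then 1 else 0.

Definition inI (u l r x : nat) : bool := has (fun y => x == y %% r) (iota u l).

Definition Tv_cover (n k v x : nat) : bool :=
  let c := cpar k in
  if inI v c.+1 n 0 || inI v c.+1 n n.-1 then inI v c.+1 n x else inI v c n x.

Local Open Scope ring_scope.

(* Mixed seeker strategies: finitely supported distributions on T_k, given as a
   list of (strategy, probability) pairs (repetitions are allowed and add up). *)
Definition seeker_strat {R : realFieldType} (n k : nat) (x : seq (tree * R)) : Prop :=
  [/\ all (fun p => in_Tk n k p.1) x, all (fun p => 0 <= p.2) x
    & \sum_(p <- x) p.2 = 1].

Definition payoff {R : realFieldType} (n : nat) (x : seq (tree * R)) (v : nat) : R :=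
  \sum_(p <- x | covers n p.1 v) p.2.

Definition hider_strat {R : realFieldType} (n : nat) (y : nat -> R) : Prop :=
  (forall v : nat, (v < n)%N -> 0 <= y v) /\ \sum_(v < n) y v = 1.

Definition hpayoff {R : realFieldType} (n : nat) (y : nat -> R) (T : tree) : R :=
  \sum_(v < n | covers n T v) y v.

(* Greedy algorithm: the sequence of vertices v visited by the while loop
   (the loop visits at most n distinct values before terminating or cycling). *)
Fixpoint greedy_vs (c m fuel v : nat) : seq nat :=
  match fuel with
  | 0 => [::]
  | f.+1 => if (v == 0) || (v == 1) then [::]
            else v :: greedy_vs c m f ((v + c) %% m)
  end.

Definition greedy_X (n k : nat) (Tv : nat -> tree) : seq tree :=
  undup (Tv 0 :: map Tv (greedy_vs (cpar k) n.-1 n (cpar k).+1)).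

Definition greedy {R : realFieldType} (n k : nat) (Tv : nat -> tree) : seq (tree * R) :=
  [seq (T, 1 / (size (greedy_X n k Tv))%:R) | T <- greedy_X n k Tv].

Definition ync {R : realFieldType} (n k w : nat) (v : nat) : R :=
  let d := gcdn (cpar k) n.-1 in
  if (d %| v)%N then 0 else 1 / (w%:R * (d.-1)%:R).

(* Hider strategy y^cp: segments built greedily from v = 1; s is the sum
   y_1 + ... + y_{v-1} accumulated so far. *)
Fixpoint cp_aux {R : realFieldType} (n c h w : nat) (fuel v : nat) (s : R) (i : nat) : R :=
  match fuel with
  | 0 => 0
  | f.+1 =>
    if (n - 2 < v)%N then 0 else
    let r := (c %/ h)%N in
    let g := fun u : nat => (u%:R * h%:R / (w%:R * c%:R) : R) in
    let rs := if g (v + r.+1 - 1)%N <= s + 1 / w%:R then r.+1 else r in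
    let val := 1 / (rs%:R * w%:R) in
    if ((v <= i) && (i < v + rs))%N then val
    else cp_aux n c h w f (v + rs)%N (s + rs%:R * val) i
  end.

Definition ycp {R : realFieldType} (n k h w : nat) (i : nat) : R :=
  if (i == 0)%N || (i == n.-1) then 0 else cp_aux n (cpar k) h w n 1 0 i.

(* Main.v *)
Require Import Defs.
From HB Require Import structures.
From mathcomp Require Import all_boot all_order all_algebra.
From mathcomp Require Import zify ring lra.
Import Order.TTheory GRing.Theory Num.Theory.
Local Open Scope ring_scope.

(* Write m = n - 1.  Arrange the cycle obtained from the path by identifying its
   two ends; the strategies T_v used by the greedy algorithm cover consecutive
   arcs of length c, which together wind h times around that cycle (in the
   coprime case one vertex short, which T_0 makes up for), so every vertex is
   covered by at least h of the w strategies.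

   Conversely, a strategy of height k cuts the path into at most 2 ^ k
   intervals, and only the singleton ones yield mass.  Let Z be the prefix sums
   of a hider strategy.  If Z is subadditive, almost superadditive
   (Z i + Z j <= Z (i + j + 1)) and symmetric, then the covered runs can be
   merged one after the other into a single run of length c starting at vertex
   1, whose mass Z c equals h / w.  For y^nc these properties are facts about
   x - floor (x / d).  For y^cp, Z is a linear function plus a multiple of the
   number of vertices in short segments, so they reduce to properties of that
   integer count. *)

(** * Bounding the payoff of a single search strategy *)

(* The leaves of a strategy cut the path into consecutive intervals; [s] lists
   their right ends plus one, [p] is the left end of the first one, and only
   the singleton intervals contribute. *)
Fixpoint singleton_mass {R : nmodType} (y : nat -> R) (p : nat) (s : seq nat) : R :=
  if s is q :: s' then (if q == p.+1 then y p else 0) + singleton_mass y q s'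
  else 0.

Lemma singleton_mass_cat (R : nmodType) (y : nat -> R) p s1 s2 :
  singleton_mass y p (s1 ++ s2) =
  singleton_mass y p s1 + singleton_mass y (last p s1) s2.
Proof. by elim: s1 p => [|q s1 IH] p /=; rewrite ?add0r // IH addrA. Qed.

Lemma cov_range a b T v :
  (a <= b)%N -> valid a b T -> cov a b T v -> (a <= v <= b)%N.
Proof.
elim: T a b => [|e l IHl r IHr] a b /= ab.
  by move=> _ /andP[/eqP E /eqP ->]; rewrite -E leqnn.
case/andP=> /andP[/andP[ae eb] vl] vr /orP[] /[dup] H.
  by move/(IHl _ _ ae vl); lia.
by move/(IHr _ _ eb vr); lia.
Qed.

(** The lists of the two subtrees are concatenated, so lengths at most double per level; by
    [cov_range] the subtrees cover disjoint sets, so the masses add. *)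
Lemma cov_singleton_mass (R : nmodType) (y : nat -> R) n a b T :
  (a <= b)%N -> (b < n)%N -> valid a b T ->
  exists s, [/\ path ltn a s, last a s = b.+1, (size s <= 2 ^ height T)%N
    & \sum_(v < n | cov a b T v) y v = singleton_mass y a s].
Proof.
move=> ab bn; elim: T a b ab bn => [|e l IHl r IHr] a b ab bn /=.
  move=> _; exists [:: b.+1]; split=> //=; first by rewrite ltnS ab.
  rewrite addr0 eqSS; case: (eqVneq a b) => [_|_] /=; last exact: big_pred0_eq.
  by rewrite (big_pred1 (Ordinal (leq_ltn_trans ab bn))).
case/andP=> /andP[/andP[ae eb] vl] vr.
have [s1 [p1 l1 z1 E1]] := IHl _ _ ae (ltn_trans eb bn) vl.
have [s2 [p2 l2 z2 E2]] := IHr _ _ eb bn vr.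
exists (s1 ++ s2); split.
- by rewrite cat_path p1 l1.
- by rewrite last_cat l1.
- rewrite size_cat expnS mul2n -addnn leq_add //.
    by rewrite (leq_trans z1) // leq_exp2l // leq_maxl.
  by rewrite (leq_trans z2) // leq_exp2l // leq_maxr.
rewrite singleton_mass_cat l1 -E1 -E2 (bigID (fun v : 'I_n => cov a e l v)) /=.
congr (_ + _); apply: eq_bigl => v; first by case: (cov a e l v); rewrite /= ?andbF.
case: (boolP (cov a e l v)) => /= Hl; last by rewrite andbT.
apply/esym/negP => Hr.
have := cov_range _ _ _ _ ae vl Hl; have := cov_range _ _ _ _ eb vr Hr; lia.
Qed.

(* The current run is [u, p); [Z t.-1] bounds the mass of the runs closed so
   far, where [t] counts the leaves before the current run minus one.  Closing
   a run costs one leaf, which pays for the [.+1] in the superadditivity bound. *)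
Lemma singleton_mass_after_gap (R : realDomainType) (Z y : nat -> R) m c s p u t :
  (c.+2 <= m)%N -> Z 0%N = 0 ->
  (forall i, (i < m)%N -> y i.+1 = Z i.+1 - Z i) ->
  (forall i j, (i + j < m)%N -> Z (i + j)%N <= Z i + Z j) ->
  (forall i j, (i + j < c)%N -> Z i + Z j <= Z (i + j).+1) ->
  (forall i, (i < m)%N -> Z i + Z (m.-1 - i)%N = Z m) ->
  (0 < u <= p)%N -> path ltn p s -> last p s = m.+1 ->
  (t + (p - u) + size s <= c.+1)%N ->
  Z t.-1 + (Z p.-1 - Z u.-1) + singleton_mass y p s <=
  Z (t + (p - u) + size s).-1.
Proof.
move=> cm Z0 yZ sub sup sym; elim: s p u t => [|q s IH] p u t /=.
  move=> up _ E; rewrite addn0 addr0 E => tc; rewrite {p}E in up tc *.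
  have [Eu|un] := eqVneq u m.+1.
    by rewrite Eu subnn addn0 /= subrr addr0.
  have um : (u.-1 < m)%N by lia.
  have := sym _ um; have -> : (m.-1 - u.-1)%N = (m - u)%N by lia.
  move=> E; rewrite /= -E [X in _ + X]addrC addKr.
  case: t tc => [|t] tc /=.
    rewrite Z0 add0r add0n; have -> : (m.+1 - u).-1 = (m - u)%N by lia.
    exact: lexx.
  have -> : (t + (m.+1 - u))%N = (t + (m - u)).+1 by lia.
  by apply: sup; lia.
move=> up /andP[pq ps] ls tc.
have qm : (q <= m.+1)%N.
  rewrite -ls; elim: (s) (q) ps {IH pq ls tc} => //= q' s' IH' q0 /andP[lt].
  by move/IH'; apply: leq_trans; apply: ltnW.
case: eqP => [Eq|nq].
  have := IH q u t; rewrite Eq /= in ps ls * => /(_ _ ps ls).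
  have -> : (t + (p.+1 - u) + size s = t + (p - u) + (size s).+1)%N by lia.
  move=> /(_ _ tc) H; have {}H := H ltac:(lia).
  have Ep : y p = Z p - Z p.-1.
    by case: (p) up pq Eq => [|p'] up' pq' Eq; [lia | rewrite yZ //; lia].
  by apply: le_trans H; rewrite Ep; lra.
have := IH q q (t + (p - u)).+1 ltac:(lia) ps ls ltac:(lia).
rewrite subrr addr0 subnn addn0 add0r.
have -> : ((t + (p - u)).+1 + size s = t + (p - u) + (size s).+1)%N by lia.
apply: le_trans; rewrite lerD2r /=.
have := sub u.-1 (p - u)%N ltac:(lia).
have -> : (u.-1 + (p - u) = p.-1)%N by lia.
case: t tc => [|t] tc /=; first by rewrite Z0 add0n; lra.
have := sup t (p - u)%N ltac:(lia); have -> : (t + (p - u)).+1 = (t.+1 + (p - u))%N by lia.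
by lra.
Qed.

(** As [y 0 = 0], an initial run of [p] singletons has mass only [Z p.-1]. The first gap hands over
    to [singleton_mass_after_gap] with [t = p]. Both effects together give the [.-2]. *)
Lemma singleton_mass_from0 (R : realDomainType) (Z y : nat -> R) m c s p :
  (c.+2 <= m)%N -> Z 0%N = 0 -> y 0%N = 0 ->
  (forall i, (i < m)%N -> y i.+1 = Z i.+1 - Z i) ->
  (forall i j, (i + j < m)%N -> Z (i + j)%N <= Z i + Z j) ->
  (forall i j, (i + j < c)%N -> Z i + Z j <= Z (i + j).+1) ->
  (forall i, (i < m)%N -> Z i + Z (m.-1 - i)%N = Z m) ->
  path ltn p s -> last p s = m.+1 -> (p + size s <= c.+2)%N ->
  Z p.-1 + singleton_mass y p s <= Z (p + size s).-2.
Proof.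
move=> cm Z0 y0 yZ sub sup sym; elim: s p => [|q s IH] p /=; first by lia.
case/andP=> pq ps ls pc; case: eqP => [Eq|nq].
  rewrite Eq /= in ps ls *; have := IH _ ps ls ltac:(lia).
  rewrite addSnnS; apply: le_trans.
  case: (p) pc => [|p'] pc /=; first by rewrite y0; lra.
  by rewrite yZ; [lra | lia].
have := singleton_mass_after_gap _ _ _ _ _ s q q p cm Z0 yZ sub sup sym
  ltac:(lia) ps ls ltac:(lia).
by rewrite subrr addr0 subnn addn0 add0r addnS.
Qed.

(** Since [2 ^ k = cpar k + 2], the two leaves lost in [singleton_mass_from0] leave [Z (cpar k)]. *)
Lemma hpayoff_le (R : realFieldType) (Z y : nat -> R) n k T :
  (2 ^ k < n)%N -> (2 <= k)%N -> Z 0%N = 0 -> y 0%N = 0 ->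
  {homo Z : i j / (i <= j)%N >-> i <= j} ->
  (forall i, (i < n.-1)%N -> y i.+1 = Z i.+1 - Z i) ->
  (forall i j, (i + j < n.-1)%N -> Z (i + j)%N <= Z i + Z j) ->
  (forall i j, (i + j < cpar k)%N -> Z i + Z j <= Z (i + j).+1) ->
  (forall i, (i < n.-1)%N -> Z i + Z (n.-2 - i)%N = Z n.-1) ->
  in_Tk n k T -> hpayoff n y T <= Z (cpar k).
Proof.
move=> kn k2 Z0 y0 Zm yZ sub sup sym /andP[vT hT].
have k4 : (4 <= 2 ^ k)%N by rewrite (leq_pexp2l (m := 2) (n1 := 2)).
have [s [ps ls ss E]] := cov_singleton_mass R y n 0 n.-1 T isT ltac:(lia) vT.
have sk : (size s <= 2 ^ k)%N by rewrite (leq_trans ss) // leq_exp2l.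
have := singleton_mass_from0 _ Z y n.-1 (cpar k) s 0
  ltac:(rewrite /cpar; lia) Z0 y0 yZ sub sup sym ps ls ltac:(rewrite /cpar; lia).
rewrite /hpayoff /covers E /= Z0 !add0r; move/le_trans; apply; apply: Zm.
by rewrite /cpar; lia.
Qed.

(** * Arithmetic of [h / w] and the orbit of the greedy loop *)

(** The reduced denominator [m %/ d] of [c / m] divides [w], and it is itself admissible because
    [d > 1] keeps it at most [m.-1]; minimality then fixes [w]. *)
Lemma noncoprime_fractionE c m h w :
  (0 < c)%N -> (1 < gcdn c m)%N -> (0 < m)%N -> (0 < w)%N -> (h * m = w * c)%N ->
  (forall h' w' : nat, (0 < h')%N -> (0 < w')%N -> (w' <= m.-1)%N ->
     (h' * m = w' * c)%N -> (w <= w')%N) ->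
  (h * gcdn c m = c)%N /\ (w * gcdn c m = m)%N.
Proof.
move=> c0 d1 m0 w0 E min; set d := gcdn c m in d1 *.
have d0 : (0 < d)%N by lia.
have [dc dm] : (d %| c)%N /\ (d %| m)%N by rewrite dvdn_gcdl dvdn_gcdr.
have cE : (c = c %/ d * d)%N by rewrite divnK.
have mE : (m = m %/ d * d)%N by rewrite divnK.
have c0' : (0 < c %/ d)%N by rewrite divn_gt0 // dvdn_leq.
have m0' : (0 < m %/ d)%N by rewrite divn_gt0 // dvdn_leq.
have lew : (w <= m %/ d)%N.
  apply: (min (c %/ d)%N) => //; last by rewrite {2}cE {1}mE; lia.
  by move: mE m0' d1; move: (m %/ d)%N => q; nia.
have cop : coprime (m %/ d) (c %/ d).
  rewrite coprime_sym /coprime -(eqn_pmul2r d0) muln_gcdl -cE -mE mul1n.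
  by apply/eqP.
have E' : (h * (m %/ d) = w * (c %/ d))%N.
  apply/eqP; rewrite -(eqn_pmul2r d0) -!mulnA -mE -cE; exact/eqP.
have dw : (m %/ d %| w)%N by rewrite -(Gauss_dvdl _ cop) -E' dvdn_mull.
have wE : w = (m %/ d)%N by apply/eqP; rewrite eqn_leq lew dvdn_leq.
split; last by rewrite wE -mE.
have -> : h = (c %/ d)%N; last by rewrite -cE.
by apply/eqP; rewrite -(eqn_pmul2r m0') E' wE mulnC.
Qed.

Section Orbit.

(* The vertices visited by the algorithm are [(1 + j * c) %% m] for
   [0 < j < w]; the last two hypotheses rule out that the loop stops
   before [j = w]. *)
Variables (c m h w del : nat).
Hypotheses (c_ge2 : (2 <= c)%N) (c_small : (c.+2 <= m)%N).
Hypotheses (del_le1 : (del <= 1)%N) (hmE : (h * m = w * c + del)%N).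
Hypothesis avoid1 : forall q, (0 < q)%N -> (q < w)%N -> ~~ (m %| q * c)%N.
Hypothesis avoid0 : forall q, (0 < q)%N -> (q < w)%N -> ~~ (m %| (q * c).+1)%N.

Lemma visited_gt1 j : (0 < j)%N -> (j < w)%N -> (1 < (1 + j * c) %% m)%N.
Proof.
move=> j0 jw; have := avoid0 _ j0 jw; have := avoid1 _ j0 jw.
rewrite add1n /dvdn; have := divn_eq (j * c).+1 m.
have m0 : (0 < m)%N by lia.
have := ltn_pmod (j * c).+1 m0.
case: ((j * c).+1 %% m)%N => [|[|r]] //= _ E /negP[].
move: (_ %/ m)%N E => q E; have -> : (j * c = q * m)%N by lia.
by rewrite modnMl.
Qed.

Lemma visited_inj i j : (i < w)%N -> (j < w)%N ->
  ((1 + i * c) %% m = (1 + j * c) %% m)%N -> i = j.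
Proof.
wlog ij : i j / (i <= j)%N.
  by move=> H iw jw E; case/orP: (leq_total i j) => ij; [|symmetry]; exact: H.
move=> iw jw E; apply/eqP; rewrite eqn_leq ij leqNgt; apply/negP => lt.
have /negP[] := avoid1 (j - i) ltac:(lia) ltac:(lia).
rewrite mulnBl -(subnDl 1) -eqn_mod_dvd ?E //.
by rewrite leq_add2l leq_mul2r ij orbT.
Qed.

Lemma greedy_vsE fuel j : (0 < j <= w)%N -> (w - j <= fuel)%N ->
  greedy_vs c m fuel ((1 + j * c) %% m) =
  [seq ((1 + i * c) %% m)%N | i <- iota j (w - j)].
Proof.
elim: fuel j => [|f IH] j jw fj; first by have -> : (w - j = 0)%N by lia.
have [Ej|nj] := eqVneq j w; rewrite /=.
  (* As [1 + w * c = h * m + 1 - del], the loop stops at vertex [1] if [del = 0] and at vertex [0]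
     if [del = 1]. *)
  rewrite Ej subnn /=; have [|] : del = 0%N \/ del = 1%N by lia.
    move=> d0; have -> : (1 + w * c = h * m + 1)%N by rewrite hmE d0; lia.
    by rewrite modnMDl modn_small; [rewrite orbT | lia].
  by move=> d1; rewrite addnC -d1 -hmE modnMl.
have := visited_gt1 j ltac:(lia) ltac:(lia).
case: eqP => [->|_] //; case: eqP => [->|_] //= _.
have -> : (w - j = (w - j.+1).+1)%N by lia.
rewrite /= -IH; [|lia|lia]; congr (_ :: greedy_vs _ _ _ _).
by rewrite modnDml; congr (_ %% _)%N; lia.
Qed.

End Orbit.

(** * Vertex sets covered by the strategies [Tv v] *)

Lemma inIE u l n x : (u <= n)%N -> (x < n)%N -> (u + l <= n + n)%N ->
  inI u l n x = ((u <= x < u + l) || (x + n < u + l))%N.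
Proof.
move=> un xn ul; apply/hasP/idP => [[y]|].
  rewrite mem_iota => yr /eqP E.
  have [yn|yn] := ltnP y n; first by rewrite modn_small // in E; lia.
  have E' : (y = y - n + n)%N by lia.
  by rewrite E' modnDr modn_small in E; lia.
case/orP=> H; first by exists x; rewrite ?mem_iota ?modn_small.
by exists (x + n)%N; rewrite ?mem_iota ?modnDr ?modn_small //; lia.
Qed.

Lemma Tv_cover0 n k x : (2 <= k)%N -> (2 ^ k < n)%N -> (x < n)%N ->
  Tv_cover n k 0 x = (x <= cpar k)%N.
Proof.
move=> k2 kn xn; have k4 : (4 <= 2 ^ k)%N by rewrite (leq_pexp2l (m := 2) (n1 := 2)).
by rewrite /Tv_cover !inIE /cpar; try lia; case: ifP; lia.
Qed.

(** From [v > 1], an interval of [cpar k + 1] vertices meets an end exactly when it reaches [n.-1].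
    If it wraps around, its extra vertex pays for the two ends being one point of the cycle. *)
Lemma Tv_cover_gt1 n k v x :
  (2 <= k)%N -> (2 ^ k < n)%N -> (1 < v)%N -> (v < n.-1)%N -> (x < n)%N ->
  Tv_cover n k v x =
  if (v + cpar k < n.-1)%N then (v <= x < v + cpar k)%N
  else (v <= x)%N || (x + n <= v + cpar k)%N.
Proof.
move=> k2 kn v1 vn xn; have k4 : (4 <= 2 ^ k)%N by rewrite (leq_pexp2l (m := 2) (n1 := 2)).
rewrite /Tv_cover !inIE /cpar; try lia.
by case: ifP; case: ifP; lia.
Qed.

(** If [v < v'] and the strategy of [v] covers [v'], it also covers [v'.-1], which the strategy of
    [v'] misses. Hence [undup] in [greedy_X] removes nothing. *)
Lemma Tv_inj n k Tv v v' :
  (2 <= k)%N -> (2 ^ k < n)%N -> (v < n.-1)%N -> v != 1%N ->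
  (v' < n.-1)%N -> v' != 1%N ->
  (forall v : nat, (v < n)%N -> v != 1%N ->
     in_Tk n k (Tv v) /\ (forall u, covers n (Tv v) u = Tv_cover n k v u)) ->
  Tv v = Tv v' -> v = v'.
Proof.
move=> k2 kn; wlog vv' : v v' / (v <= v')%N.
  move=> H vn v1 vn' v1' HT E.
  by case/orP: (leq_total v v') => vv'; [|symmetry]; apply: H.
move=> vn v1 vn' v1' HT E; apply/eqP; rewrite eqn_leq vv' leqNgt.
have k4 : (4 <= 2 ^ k)%N by rewrite (leq_pexp2l (m := 2) (n1 := 2)).
apply/negP => lt.
have C x : Tv_cover n k v x = Tv_cover n k v' x.
  have [_ <-] := HT v ltac:(lia) v1.
  by have [_ <-] := HT v' ltac:(lia) v1'; rewrite E.
have := C v'; have := C v'.-1.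
case: v lt v1 vn {vv' HT E C} => [|v] lt v1 vn; last first.
  by rewrite !Tv_cover_gt1 /cpar; try lia; do 2!case: ifP; lia.
by rewrite !Tv_cover0 // ?Tv_cover_gt1 /cpar; try lia; do 2?case: ifP; lia.
Qed.

(** * Coverage by the greedy seeker strategy *)

Section GreedyOptimal.

Variables (k n h w del : nat) (Tv : nat -> tree).
Local Notation c := (cpar k).
Local Notation m := n.-1.
Hypotheses (k_ge2 : (2 <= k)%N) (n_gt : (2 ^ k < n)%N).
Hypotheses (w_gt0 : (0 < w)%N) (w_lt : (w < m)%N) (h_gt0 : (0 < h)%N).
Hypotheses (del_le1 : (del <= 1)%N) (hmE : (h * m = w * c + del)%N).
Hypothesis avoid1 : forall q, (0 < q)%N -> (q < w)%N -> ~~ (m %| q * c)%N.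
Hypothesis avoid0 : forall q, (0 < q)%N -> (q < w)%N -> ~~ (m %| (q * c).+1)%N.
Hypothesis TvP : forall v : nat, (v < n)%N -> v != 1%N ->
  in_Tk n k (Tv v) /\ (forall u, covers n (Tv v) u = Tv_cover n k v u).

(** At [j = 0] the formula would give vertex [1], which [TvP] excludes; [T_0] stands in for it. *)
Let greedy_vertex j := if j == 0%N then 0%N else ((1 + j * c) %% m)%N.

Let c_ge2 : (2 <= c)%N.
Proof.
by have := leq_pexp2l (isT : 0 < 2)%N k_ge2; rewrite /cpar; lia.
Qed.

Let c_small : (c.+2 <= m)%N.
Proof. by move: c_ge2 n_gt; rewrite /cpar; lia. Qed.

Let greedy_vertex_lt j : (j < w)%N -> (greedy_vertex j < m)%N.
Proof.
by move=> jw; rewrite /greedy_vertex; case: ifP => _; [lia | rewrite ltn_pmod //; lia].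
Qed.

Let greedy_vertex_neq1 j : (j < w)%N -> greedy_vertex j != 1%N.
Proof.
move=> jw; rewrite /greedy_vertex; case: ifPn => // j0.
by rewrite gtn_eqF // (visited_gt1 c m h w del) // lt0n.
Qed.

Let greedy_vertex_inj : {in [pred j | (j < w)%N] &, injective greedy_vertex}.
Proof.
have gt1 j := visited_gt1 c m h w del c_ge2 c_small del_le1 hmE avoid1 avoid0 j.
move=> i j; rewrite !inE /greedy_vertex => iw jw.
case: eqVneq => [->|i0]; case: eqVneq => [->|j0] // E.
- by have := gt1 j ltac:(rewrite lt0n //) jw; rewrite -E.
- by have := gt1 i ltac:(rewrite lt0n //) iw; rewrite E.
- exact: (visited_inj c m h w del) E.
Qed.

Let TvE j : (j < w)%N -> in_Tk n k (Tv (greedy_vertex j)) /\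
  (forall u, covers n (Tv (greedy_vertex j)) u = Tv_cover n k (greedy_vertex j) u).
Proof.
move=> jw; apply: TvP; last exact: greedy_vertex_neq1.
by have := greedy_vertex_lt _ jw; lia.
Qed.

Lemma greedy_XE : greedy_X n k Tv = [seq Tv (greedy_vertex j) | j <- iota 0 w].
Proof.
rewrite /greedy_X; have -> : (c.+1 = (1 + 1 * c) %% m)%N.
  by rewrite modn_small; lia.
rewrite (greedy_vsE c m h w del) //; try lia.
have -> : [:: Tv 0 & map Tv [seq ((1 + i * c) %% m)%N | i <- iota 1 (w - 1)]] =
  [seq Tv (greedy_vertex j) | j <- iota 0 w].
  case: (w) w_gt0 => // w' _; rewrite subn1 /= -map_comp; congr (_ :: _).
  by apply/eq_in_map => i; rewrite mem_iota /greedy_vertex /=; case: i.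
apply: undup_id; rewrite map_inj_in_uniq ?iota_uniq // => i j.
rewrite !mem_iota /= !add0n => iw jw E; apply: greedy_vertex_inj => //.
by apply: (Tv_inj n k Tv) E; rewrite ?greedy_vertex_lt ?greedy_vertex_neq1.
Qed.

(* Laid end to end, the arcs [[v_j, v_j + c)] wind around the cycle of length
   [m]; arc [j] occupies positions [j * c, ..., (j + 1) * c - 1] counted from
   vertex [1].  Vertex [u] sits at the positions [u + q * m - 1], and [j] is
   the arc containing that position.  The truncation at [u = q = 0] selects
   [T_0], the only strategy covering [0] without wrapping around. *)
Lemma greedy_cover u q j : (u < n)%N -> (q < h)%N ->
  (j = ((if u == m then u.-1 else u) + q * m - 1) %/ c)%N ->
  (j < w)%N /\ covers n (Tv (greedy_vertex j)) u.
Proof.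
set u' := if _ then _ else _ => un qh jE.
have u'm : (u' < m)%N by rewrite /u'; case: eqP; lia.
have c0 : (0 < c)%N by lia.
have qhm : (q * m + m <= h * m)%N by rewrite addnC -mulSn leq_mul2r qh orbT.
have pE := divn_eq (u' + q * m - 1) c; rewrite -jE in pE.
have t_lt := ltn_pmod (u' + q * m - 1) c0; move: (_ %% c)%N t_lt pE => t tc pE.
(* The position is at most [h * m - 2], which is below [w * c] because [del <= 1]. *)
have jw : (j < w)%N.
  by rewrite -(ltn_pmul2r c0); lia.
split=> //; have [_ ->] := TvE _ jw.
have [j0|j0] := eqVneq j 0%N.
  rewrite /greedy_vertex j0 /= Tv_cover0 //.
  move: pE; rewrite j0 mul0n add0n /u'; case: eqP => um pE; first by lia.
  case: (q) pE => [|q'] pE; first by lia.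
  by rewrite mulSn in pE; move: (q' * m)%N pE => z; lia.
rewrite /greedy_vertex (negPf j0).
have v1 := visited_gt1 c m h w del c_ge2 c_small del_le1 hmE avoid1 avoid0 j ltac:(lia) jw.
have vm : ((1 + j * c) %% m < m)%N by rewrite ltn_pmod //; lia.
have vt : ((1 + j * c) %% m + t = u' %[mod m])%N.
  rewrite modnDml; have jc : (0 < j * c)%N by rewrite muln_gt0; lia.
  have -> : (1 + j * c + t = q * m + u')%N by lia.
  by rewrite modnMDl.
move: ((1 + j * c) %% m)%N v1 vm vt => v v1 vm vt.
have {}vt : (v + t = u' \/ v + t = u' + m)%N.
  rewrite [(u' %% m)%N]modn_small // in vt.
  have [lt|ge] := ltnP (v + t) m; first by rewrite modn_small in vt; auto.
  right; rewrite -vt -(subnK ge) modnDr modn_small; lia.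
rewrite Tv_cover_gt1 //; move: vt; rewrite /u'; case: eqP => um; case: ifP; lia.
Qed.

(** Successive values of [q] move the position by at least [m - 1 > c], hence into another arc, so
    the [h] values of [q] select [h] distinct indices. *)
Lemma count_greedy_cover u : (u < n)%N ->
  (h <= count (fun T => covers n T u) (greedy_X n k Tv))%N.
Proof.
move=> un; rewrite greedy_XE count_map -size_filter.
pose j q := (((if u == m then u.-1 else u) + q * m - 1) %/ c)%N.
have c0 : (0 < c)%N by lia.
have j_lt q : (j q < j q.+1)%N.
  rewrite /j leq_divRL // !mulSn.
  have := leq_trunc_div ((if u == m then u.-1 else u) + q * m - 1) c.
  by move: (_ %/ c)%N => z; lia.
rewrite -{1}(size_iota 0 h) -(size_map j); apply: uniq_leq_size.
  rewrite map_inj_uniq ?iota_uniq //; apply: incn_inj.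
  exact: leq_mono (homo_ltn ltn_trans j_lt).
move=> x /mapP[q]; rewrite mem_iota add0n => qh ->.
have [jw cv] := greedy_cover u q _ un qh erefl.
by rewrite mem_filter /= cv mem_iota.
Qed.

Lemma greedy_seeker_strat (R : realFieldType) :
  seeker_strat n k (greedy (R := R) n k Tv).
Proof.
have sX : size (greedy_X n k Tv) = w by rewrite greedy_XE size_map size_iota.
rewrite /greedy sX; split.
- rewrite all_map greedy_XE; apply/allP => T /mapP[j]; rewrite mem_iota => jw ->.
  by have [] := TvE j jw.
- by rewrite all_map; apply/allP => T _ /=; rewrite divr_ge0 // ler0n.
- rewrite big_map /= big_const_seq count_predT sX iter_addr_0.
  by rewrite -[LHS]mulr_natl mul1r divff // pnatr_eq0; lia.
Qed.

Lemma greedy_payoff_ge (R : realFieldType) v : (v < n)%N ->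
  h%:R / w%:R <= payoff n (greedy (R := R) n k Tv) v.
Proof.
move=> vn; have sX : size (greedy_X n k Tv) = w by rewrite greedy_XE size_map size_iota.
rewrite /payoff /greedy sX big_map /= big_const_seq iter_addr_0 -[leRHS]mulr_natl mul1r.
by rewrite ler_pM2r ?invr_gt0 ?ltr0n // ler_nat count_greedy_cover.
Qed.

End GreedyOptimal.

(** * Segments of y^cp: ends, remainders and short segments *)

Section SegmentEnds.

(* [seg_end j = floor (j * c / h)] is the last vertex of the [j]-th segment of
   y^cp; a segment has length [r] or [r.+1], and the short ones are those whose
   remainder leaves room below [h]. *)
Variables (c h : nat).
Hypotheses (h_gt0 : (0 < h)%N) (h_le : (h <= c)%N).
Local Notation r := (c %/ h)%N.

Definition seg_end j := (j * c %/ h)%N.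

Definition seg_rem j := (j * c %% h)%N.

Definition seg_short j : bool := (seg_rem j + c %% h < h)%N.

Lemma short_length_gt0 : (0 < r)%N. Proof. by rewrite divn_gt0. Qed.

Lemma seg_rem_lt j : (seg_rem j < h)%N. Proof. exact: ltn_pmod. Qed.

Lemma seg_end0 : seg_end 0 = 0%N. Proof. by rewrite /seg_end mul0n div0n. Qed.

Lemma seg_endS j : (seg_end j.+1 = seg_end j + (r + ~~ seg_short j))%N.
Proof. by rewrite /seg_end mulSn addnC divnD // /seg_short -leqNgt addnA. Qed.

Lemma seg_remS j :
  (seg_rem j.+1 = seg_rem j + c %% h - ~~ seg_short j * h)%N.
Proof. by rewrite /seg_rem mulSn addnC modnD // /seg_short -leqNgt. Qed.

Lemma seg_end_add i j :
  (seg_end (i + j) = seg_end i + seg_end j + (h <= seg_rem i + seg_rem j))%N.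
Proof. by rewrite /seg_end mulnDl divnD. Qed.

Lemma seg_rem_add i j :
  (seg_rem (i + j) =
   seg_rem i + seg_rem j - (h <= seg_rem i + seg_rem j) * h)%N.
Proof. by rewrite /seg_rem mulnDl modnD. Qed.

(* [(r.+1)%:R * r%:R * w%:R * (y_1 + ... + y_x) = r * x + short_mass x]: the
   vertices of short segments contribute one more than the others. *)
Definition seg_of x := ((x.+1 * h).-1 %/ c)%N.

(** The number of short ones among the first [j] segments: each falls one vertex below the length
    [r.+1]. *)
Definition short_before j := (j * r.+1 - seg_end j)%N.

Definition short_mass x :=
  (r * short_before (seg_of x) + seg_short (seg_of x) * (x - seg_end (seg_of x)))%N.

Lemma seg_end_le j : (seg_end j <= j * r.+1)%N.
Proof.
elim: j => [|j IH]; first by rewrite seg_end0.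
by rewrite seg_endS mulSn; case: (seg_short j); lia.
Qed.

Lemma short_beforeS j : (short_before j.+1 = short_before j + seg_short j)%N.
Proof.
rewrite /short_before seg_endS mulSn; have := seg_end_le j.
by case: (seg_short j) => /=; lia.
Qed.

Lemma short_before_add i j :
  (short_before (i + j) + (h <= seg_rem i + seg_rem j) =
   short_before i + short_before j)%N.
Proof.
rewrite /short_before; have := seg_end_le (i + j).
have := seg_end_le i; have := seg_end_le j.
by rewrite seg_end_add mulnDl; case: (h <= _)%N => /=; lia.
Qed.

(** Both sides say [j * c < x.+1 * h]; this explains the formula of [seg_of]. *)
Lemma seg_end_leE j x : (seg_end j <= x)%N = (j <= seg_of x)%N.
Proof.
rewrite /seg_end /seg_of leq_divRL; last exact: leq_trans h_le.
by rewrite -ltnS ltn_divLR // -[RHS]ltnS prednK // muln_gt0.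
Qed.

Lemma seg_ofP x : (seg_end (seg_of x) <= x < seg_end (seg_of x).+1)%N.
Proof. by rewrite ltnNge !seg_end_leE leqnn ltnn. Qed.

Lemma seg_ofE j x : (seg_end j <= x)%N -> (x < seg_end j.+1)%N -> seg_of x = j.
Proof.
by rewrite ltnNge !seg_end_leE -ltnNge ltnS => lo hi; apply/eqP; rewrite eqn_leq hi.
Qed.

(** [t] may be the full length: a short segment has [r] vertices, so the value agrees with that of
    the next segment at offset [0]. *)
Lemma short_mass_seg j t : (t <= r + ~~ seg_short j)%N ->
  short_mass (seg_end j + t) = (r * short_before j + seg_short j * t)%N.
Proof.
have r0 := short_length_gt0; rewrite leq_eqVlt => /orP[/eqP->|lt].
  rewrite -seg_endS /short_mass (seg_ofE j.+1) ?subnn ?muln0 ?addn0 //.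
    by rewrite short_beforeS mulnDr; case: (seg_short j) => /=; lia.
  by rewrite [ltnRHS]seg_endS -addn1 leq_add2l ltn_addr.
rewrite /short_mass (seg_ofE j) ?addKn ?leq_addr //.
by rewrite seg_endS ltn_add2l.
Qed.

(** Needed because sums can spill over from segment [i + j] into the next one. *)
Lemma short_mass_seg2 j t : (r + ~~ seg_short j <= t)%N ->
  (t <= r + ~~ seg_short j + (r + ~~ seg_short j.+1))%N ->
  short_mass (seg_end j + t) =
  (r * short_before j + seg_short j * r +
   seg_short j.+1 * (t - (r + ~~ seg_short j)))%N.
Proof.
move=> lo hi; rewrite -(subnKC lo) addnA -seg_endS short_mass_seg; last by lia.
by rewrite short_beforeS mulnDr addKn [(r * seg_short j)%N]mulnC.
Qed.

Lemma short_massS x :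
  short_mass x.+1 = (short_mass x + seg_short (seg_of x))%N.
Proof.
have /andP[lo hi] := seg_ofP x; move: (seg_of x) lo hi => j lo hi.
rewrite seg_endS in hi; rewrite -(subnKC lo) -addnS !short_mass_seg; last lia.
  by rewrite mulnS; lia.
by lia.
Qed.

Lemma short_mass_homo : {homo short_mass : x y / (x <= y)%N}.
Proof. by apply: homo_leq => [//|x|x]; [apply: leq_trans | rewrite short_massS leq_addr]. Qed.

(** With a carry the remainder of [i + j] is below both remainders, without one it is at least both.
    The resulting implications cut down the boolean cases of the two inequalities below. *)
Lemma seg_short_add i j :
  if (h <= seg_rem i + seg_rem j)%N then
    (seg_short i || seg_short j ==> seg_short (i + j)) &&
    (seg_short (i + j) ==> (seg_short i && seg_short j ==> seg_short (i + j).+1)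
      && (seg_short (i + j).+1 ==> seg_short i || seg_short j))
  else
    (seg_short (i + j) ==> seg_short i && seg_short j) &&
    (~~ seg_short (i + j) ==> (seg_short i && seg_short j ==> seg_short (i + j).+1)
      && (seg_short (i + j).+1 ==> seg_short i || seg_short j)).
Proof.
have := seg_remS (i + j); have := seg_rem_add i j.
have := seg_rem_lt (i + j).+1; have := seg_rem_lt (i + j).
have := seg_rem_lt i; have := seg_rem_lt j; have := ltn_pmod c h_gt0.
rewrite /seg_short.
move: (seg_rem (i + j).+1) (seg_rem (i + j)) (seg_rem i) (seg_rem j) (c %% h)%N.
move=> a1 a ai aj f fh ajh aih ah a1h.
case: (leqP h (ai + aj)) => H0; rewrite ?mul1n ?mul0n ?subn0 => -> .
  by case: (ltnP (_ + f)) => /= H; rewrite ?mul1n ?mul0n ?subn0 => E; lia.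
by case: (ltnP (_ + f)) => /= H; rewrite ?mul1n ?mul0n ?subn0 => E; lia.
Qed.

Lemma seg_decomp x : exists j t,
  x = (seg_end j + t)%N /\ (t < r + ~~ seg_short j)%N.
Proof.
have /andP[lo hi] := seg_ofP x; exists (seg_of x), (x - seg_end (seg_of x))%N.
by rewrite subnKC // ltn_subLR // -seg_endS.
Qed.

Lemma short_mass_sub x y : (short_mass (x + y) <= short_mass x + short_mass y)%N.
Proof.
have r0 := short_length_gt0.
have [i [s [-> sl]]] := seg_decomp x; have [j [t [-> tl]]] := seg_decomp y.
rewrite !short_mass_seg; try exact: ltnW.
have Ae := short_before_add i j; have Ee := seg_end_add i j.
have := seg_short_add i j; have T1 := short_mass_seg (i + j).
have T2 := short_mass_seg2 (i + j).
have rA : (r * short_before (i + j) + r * (h <= seg_rem i + seg_rem j) =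
   r * short_before i + r * short_before j)%N by rewrite -!mulnDr Ae.
have mono := short_mass_homo (seg_end i + s + (seg_end j + t))%N.
have T0 := short_mass_seg (i + j) 0 ltac:(lia).
move: Ee T1 T2 mono T0 rA.
move: (seg_end (i + j)) (seg_end i) (seg_end j) => ek ei ej.
move: (r * short_before (i + j))%N (r * short_before i)%N (r * short_before j)%N => Rk Ri Rj.
move: (c %/ h)%N r0 sl tl => q q0; clear Ae.
case: (h <= _)%N => /= sl tl Ee T1 T2 mono T0 rA P.
  (* With a carry [seg_end (i + j)] gains one, so for [s = t = 0] the sum falls just below it and
     monotonicity is enough. *)
  have [st|st] := posnP (s + t)%N.
    by have := mono ek ltac:(lia); rewrite -[ek]addn0 T0; lia.
  have -> : (ei + s + (ej + t) = ek + (s + t).-1)%N by lia.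
  move: T1 T2 => /(_ (s + t).-1) T1 /(_ (s + t).-1) T2 {mono T0}.
  have [le|ge] := leqP (s + t).-1 (q + ~~ seg_short (i + j)).
    rewrite T1 //; move: (seg_short (i + j)) (seg_short i) (seg_short j)
      P tl sl le {T1 T2}.
    by move=> [] [] [] /=; lia.
  rewrite T2; [|lia|]; move: (seg_short (i + j)) (seg_short i) (seg_short j)
    (seg_short _.+1) P tl sl ge {T1 T2} => [] [] [] [] /=; lia.
have -> : (ei + s + (ej + t) = ek + (s + t))%N by lia.
move: T1 T2 => /(_ (s + t)%N) T1 /(_ (s + t)%N) T2 {mono T0}.
have [le|ge] := leqP (s + t)%N (q + ~~ seg_short (i + j)).
  rewrite T1 //; move: (seg_short (i + j)) (seg_short i) (seg_short j)
    P tl sl le {T1 T2}.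
  by move=> [] [] [] /=; lia.
rewrite T2; [|lia|]; move: (seg_short (i + j)) (seg_short i) (seg_short j)
  (seg_short _.+1) P tl sl ge {T1 T2} => [] [] [] [] /=; lia.
Qed.

(** The slack [r] is the linear contribution of the additional vertex in [cp_sum_sup]. *)
Lemma short_mass_sup x y :
  (short_mass x + short_mass y <= short_mass (x + y).+1 + r)%N.
Proof.
have r0 := short_length_gt0.
have [i [s [-> sl]]] := seg_decomp x; have [j [t [-> tl]]] := seg_decomp y.
rewrite !short_mass_seg; try exact: ltnW.
have Ae := short_before_add i j; have Ee := seg_end_add i j.
have := seg_short_add i j; have T1 := short_mass_seg (i + j).
have T2 := short_mass_seg2 (i + j).
have rA : (r * short_before (i + j) + r * (h <= seg_rem i + seg_rem j) =
   r * short_before i + r * short_before j)%N by rewrite -!mulnDr Ae.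
have mono a := short_mass_homo a (seg_end i + s + (seg_end j + t)).+1.
move: Ee T1 T2 mono rA.
move: (seg_end (i + j)) (seg_end i) (seg_end j) => ek ei ej.
move: (r * short_before (i + j))%N (r * short_before i)%N (r * short_before j)%N => Rk Ri Rj.
move: (c %/ h)%N r0 sl tl => q q0; clear Ae => sl tl Ee T1 T2 mono rA.
have [u [uE uhi]] : exists u, (ei + s + (ej + t)).+1 = (ek + u)%N /\
    u = (s + t + ~~ (h <= seg_rem i + seg_rem j))%N.
  by exists (s + t + ~~ (h <= seg_rem i + seg_rem j))%N; case: (h <= _)%N Ee; lia.
rewrite uE in mono *; move: (T1 u) (T2 u) => {}T1 T2u.
(* [L] is the joint length of segments [i + j] and [i + j + 1]; from [L <= u] on, monotonicity gives
   the bound. *)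
set L := (q + ~~ seg_short (i + j) + (q + ~~ seg_short (i + j).+1))%N in T2u T2 *.
have {T2} T2 := T2 L ltac:(rewrite /L; lia) (leqnn _).
have {}mono : (L <= u)%N -> _ := fun lu => mono (ek + L)%N ltac:(by rewrite leq_add2l).
move: T1 T2u T2 mono rA uhi {uE Ee}; rewrite /L.
move: (short_mass _) (short_mass _) => Sl Su.
case: (h <= _)%N; move: sl tl; move: (seg_short (i + j)) (seg_short i) (seg_short j)
  (seg_short _.+1) => [] [] [] [] /=; lia.
Qed.

End SegmentEnds.

(** * The hider strategy y^cp in the coprime case *)

Section CoprimeHider.

Variables (n k h w : nat).
Local Notation c := (cpar k).
Local Notation m := n.-1.
Local Notation r := (c %/ h)%N.
Hypotheses (h_gt0 : (0 < h)%N) (h_le : (h <= c)%N) (w_gt0 : (0 < w)%N) (w_lt : (w < m)%N).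
Hypotheses (n_gt : (c.+2 <= m)%N) (hmE : (h * m = w * c + 1)%N).

Lemma seg_end_h : seg_end c h h = c.
Proof. by rewrite /seg_end mulKn. Qed.

(* [floor ((w - j) * c / h) = m - ceil ((j * c + 1) / h)]. *)
Lemma seg_end_sym j : (j <= w)%N -> (seg_end c h (w - j) + seg_end c h j = m.-1)%N.
Proof.
move=> jw; have E : ((w - j) * c + (j * c + 1) = m * h)%N.
  by rewrite addnA -mulnDl subnK // [RHS]mulnC hmE.
have := divn_eq (j * c) h; have := ltn_pmod (j * c) h_gt0.
rewrite -/(seg_end c h j); move: (_ %% h)%N => b bh jE.
have bm : (seg_end c h j < m)%N.
  by rewrite -(ltn_pmul2r h_gt0); lia.
have -> : (seg_end c h (w - j) = m.-1 - seg_end c h j)%N; last by lia.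
rewrite /seg_end; have -> : ((w - j) * c = (m.-1 - seg_end c h j) * h + (h - b.+1))%N.
  have := mulnBl m.-1 (seg_end c h j) h; have := mulSn m.-1 h.
  rewrite prednK; last by lia.
  have : (seg_end c h j * h <= m.-1 * h)%N by rewrite leq_mul2r; lia.
  move: E; rewrite {1}jE; lia.
by rewrite divnMDl // divn_small ?addn0 //; lia.
Qed.

Lemma seg_end_w : seg_end c h w = m.-1.
Proof. by have := seg_end_sym w (leqnn w); rewrite subnn seg_end0. Qed.

(** The reflection [v -> m - v] maps segment [j] onto segment [w - j.+1]. *)
Lemma seg_short_sym j : (j < w)%N -> seg_short c h (w - j.+1) = seg_short c h j.
Proof.
move=> jw; have := seg_end_sym j (ltnW jw); have := seg_end_sym j.+1 jw.
have {1}-> : (w - j = (w - j.+1).+1)%N by lia.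
rewrite !seg_endS //.
by case: (seg_short c h j); case: (seg_short c h (w - _)) => /=; lia.
Qed.

Lemma short_before_w j : (j <= w)%N ->
  (short_before c h j + short_before c h (w - j) = short_before c h w)%N.
Proof.
move=> jw; have := seg_end_sym j jw; rewrite /short_before seg_end_w mulnBl.
have := seg_end_le c h h_gt0 h_le j; have := seg_end_le c h h_gt0 h_le (w - j).
have : (j * r.+1 <= w * r.+1)%N by rewrite leq_mul2r jw orbT.
by rewrite mulnBl; lia.
Qed.

Lemma short_mass_w : short_mass c h m.-1 = (r * short_before c h w)%N.
Proof.
by have := short_mass_seg c h h_gt0 h_le w 0 (leq0n _); rewrite addn0 seg_end_w muln0 addn0.
Qed.

Lemma short_mass0 : short_mass c h 0 = 0%N.
Proof.
have := short_mass_seg c h h_gt0 h_le 0 0 (leq0n _).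
by rewrite seg_end0 addn0 /short_before mul0n sub0n !muln0.
Qed.

Lemma short_mass_sym x : (x <= m.-1)%N ->
  (short_mass c h x + short_mass c h (m.-1 - x) = short_mass c h m.-1)%N.
Proof.
rewrite leq_eqVlt => /orP[/eqP ->|]; first by rewrite subnn short_mass0 addn0.
have [j [t [-> tL]]] := seg_decomp c h h_gt0 h_le x => xm.
have jw : (j < w)%N.
  rewrite ltnNge; apply/negP => wj.
  have : (seg_end c h w <= seg_end c h j)%N.
    by rewrite /seg_end leq_div2r // leq_mul2r wj orbT.
  by rewrite seg_end_w; lia.
have := seg_end_sym j (ltnW jw); have := seg_short_sym j jw.
have -> : (w - j = (w - j.+1).+1)%N by lia.
rewrite seg_endS // => sE eE.
(* Offset [t] is reflected to the common length minus [t]; for [t = 0] this is the full length,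
   which [short_mass_seg] admits. *)
have -> : (m.-1 - (seg_end c h j + t) =
   seg_end c h (w - j.+1) + (r + ~~ seg_short c h j - t))%N.
  by rewrite sE in eE; lia.
rewrite !short_mass_seg //; [|by rewrite sE; lia|exact: ltnW].
rewrite short_mass_w -(short_before_w j (ltnW jw)).
have -> : (w - j = (w - j.+1).+1)%N by lia.
rewrite short_beforeS // sE !mulnDr.
by case: (seg_short c h j) tL => /=; rewrite ?addn0 => tL; lia.
Qed.

Let r_gt0 : (0 < r)%N. Proof. exact: short_length_gt0. Qed.

Variable R : realFieldType.

(** Prefix sums of y^cp over a common denominator; the cut at [m.-1] reflects that vertex [n.-1] has
    mass [0]. *)
Definition cp_sum x : R :=
  let x' := minn x m.-1 in (r * x' + short_mass c h x')%:R / (r * r.+1 * w)%:R.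

Let den_gt0 : 0 < (r * r.+1 * w)%:R :> R.
Proof. by rewrite ltr0n !muln_gt0 r_gt0 w_gt0. Qed.

Lemma cp_sum0 : cp_sum 0 = 0.
Proof. by rewrite /cp_sum min0n muln0 short_mass0 // mul0r. Qed.

Lemma cp_sum_homo : {homo cp_sum : x y / (x <= y)%N >-> x <= y}.
Proof.
move=> x y xy; rewrite /cp_sum ler_pM2r ?invr_gt0 // ler_nat.
have le : (minn x m.-1 <= minn y m.-1)%N by lia.
by rewrite leq_add ?leq_mul // short_mass_homo.
Qed.

Lemma cp_sum_sub i j : (i + j < m)%N -> cp_sum (i + j) <= cp_sum i + cp_sum j.
Proof.
move=> ij; rewrite /cp_sum -mulrDl ler_pM2r ?invr_gt0 // -natrD ler_nat.
rewrite !(minn_idPl _); try lia.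
have := short_mass_sub c h h_gt0 h_le i j; rewrite mulnDr; lia.
Qed.

Lemma cp_sum_sup i j : (i + j < c)%N -> cp_sum i + cp_sum j <= cp_sum (i + j).+1.
Proof.
move=> ij; rewrite /cp_sum -mulrDl ler_pM2r ?invr_gt0 // -natrD ler_nat.
rewrite !(minn_idPl _); try lia.
have := short_mass_sup c h h_gt0 h_le i j; rewrite mulnS mulnDr; lia.
Qed.

Lemma cp_sum_sym i : (i < m)%N -> cp_sum i + cp_sum (m.-1 - i) = cp_sum m.
Proof.
move=> im; rewrite /cp_sum -mulrDl -natrD; congr (_%:R / _).
rewrite (minn_idPr (leq_pred m)) !(minn_idPl _); try lia.
have := short_mass_sym i ltac:(lia); rewrite mulnBr.
have : (r * i <= r * m.-1)%N by rewrite leq_mul2l; lia.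
lia.
Qed.

(** Every segment has mass [1 / w]. With [seg_end_h] this yields the value [h / w], with [seg_end_w]
    the total mass [1]. *)
Lemma cp_sum_seg_end j : (j <= w)%N -> cp_sum (seg_end c h j) = j%:R / w%:R.
Proof.
move=> jw; have := seg_end_sym j jw => e.
rewrite /cp_sum (minn_idPl _); last by lia.
have := short_mass_seg c h h_gt0 h_le j 0 (leq0n _); rewrite addn0 muln0 addn0 => ->.
rewrite -mulnDr /short_before subnKC ?seg_end_le // -mulnCA -mulnA !natrM.
have [p0 q0 w0] : [/\ r%:R != 0 :> R, r.+1%:R != 0 :> R & w%:R != 0 :> R].
  by split; rewrite pnatr_eq0 -?lt0n.
by move: r%:R r.+1%:R w%:R p0 q0 w0 => p q v p0 q0 v0; field; rewrite p0 q0 v0.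
Qed.

(** The numerator of [cp_sum] grows by [r.+1] in a short segment and by [r] in a long one;
    cancelling it leaves the length of the segment. *)
Lemma cp_sum_step j t : (j < w)%N -> (t < r + ~~ seg_short c h j)%N ->
  cp_sum (seg_end c h j + t).+1 - cp_sum (seg_end c h j + t) =
  1 / ((r + ~~ seg_short c h j)%:R * w%:R).
Proof.
move=> jw tL; have := seg_end_sym j.+1 jw; rewrite seg_endS // => e.
rewrite /cp_sum !(minn_idPl _); try lia.
rewrite -addnS !short_mass_seg //; last exact: ltnW.
rewrite -mulrBl -natrB; last by rewrite leq_add // ?leq_mul // leq_add // leq_mul.
have -> : (r * (seg_end c h j + t.+1) + (r * short_before c h j + seg_short c h j * t.+1)
  - (r * (seg_end c h j + t) + (r * short_before c h j + seg_short c h j * t)) =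
  r + seg_short c h j)%N.
  by rewrite addnS !mulnS; lia.
have [p0 q0 w0] : [/\ r%:R != 0 :> R, r.+1%:R != 0 :> R & w%:R != 0 :> R].
  by split; rewrite pnatr_eq0 -?lt0n.
rewrite !natrM; case: (seg_short c h j) => /=; rewrite ?addn0 ?addn1;
  by move: r%:R r.+1%:R w%:R p0 q0 w0 => p q v p0 q0 v0; field; rewrite ?p0 ?q0 ?v0.
Qed.

(** Loop invariant: at the start of segment [j] the accumulated sum is [j / w]. *)
Lemma cp_auxE fuel j i : (j <= w)%N -> (w - j <= fuel)%N ->
  (seg_end c h j < i)%N -> (i < m)%N ->
  cp_aux n c h w fuel (seg_end c h j).+1 (j%:R / w%:R) i =
  cp_sum i - cp_sum i.-1.
Proof.
elim: fuel j => [|f IH] j jw fj ji im.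
  have jE : j = w by lia.
  by move: ji; rewrite jE seg_end_w; lia.
have {}jw : (j < w)%N.
  rewrite ltn_neqAle jw andbT; apply: contraTneq ji => ->.
  by rewrite seg_end_w -leqNgt; lia.
rewrite [LHS]/=; have -> : (n - 2 < (seg_end c h j).+1)%N = false by lia.
have w0 : w%:R != 0 :> R by rewrite pnatr_eq0; lia.
have c0 : (0 < c)%N by lia.
(* Cleared of denominators, the test is [(seg_end j + r.+1) * h <= (j + 1) * c], true exactly for
   long segments. *)
set b := (_ <= _); have -> : b = ~~ seg_short c h j.
  rewrite /b; have -> : ((seg_end c h j).+1 + r.+1 - 1 = seg_end c h j + r.+1)%N by lia.
  rewrite -mulrDl -natrM -natrM -[1]/(1%:R) -natrD ler_pdivrMr ?ltr0n ?muln_gt0 ?w_gt0 //.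
  rewrite [(w * c)%:R]natrM mulrA divfK // -natrM ler_nat -leq_divRL //.
  have -> : ((j + 1) * c %/ h = seg_end c h j.+1)%N by rewrite addn1.
  by rewrite seg_endS // leq_add2l; case: (seg_short c h j) => /=; lia.
have -> : (if ~~ seg_short c h j then r.+1 else r) = (r + ~~ seg_short c h j)%N.
  by case: (seg_short c h j); rewrite /= ?addn0 ?addn1.
case: ifP => [it|it].
  have <- := cp_sum_step j (i.-1 - seg_end c h j) jw ltac:(lia).
  by rewrite subnKC ?prednK //; lia.
have L0 : (r + ~~ seg_short c h j)%:R != 0 :> R by rewrite pnatr_eq0; lia.
have -> : j%:R / w%:R + (r + ~~ seg_short c h j)%:R *
    (1 / ((r + ~~ seg_short c h j)%:R * w%:R)) = j.+1%:R / w%:R :> R.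
  rewrite -[j.+1]addn1 [(j + 1)%:R]natrD.
  by move: (r + _)%:R w%:R L0 w0 => L v L0 v0; field; rewrite L0 v0.
rewrite addSn -seg_endS // IH //; try lia.
by rewrite seg_endS //; lia.
Qed.

Lemma ycpE i : (i < m)%N -> ycp (R := R) n k h w i.+1 = cp_sum i.+1 - cp_sum i.
Proof.
move=> im; rewrite /ycp /=; case: eqP => [im'|im'].
  by rewrite /cp_sum !(minn_idPr _) ?subrr //; lia.
have := cp_auxE n 0 i.+1 (leq0n _); rewrite seg_end0 mul0r; apply; lia.
Qed.

Lemma ycp0 : ycp (R := R) n k h w 0 = 0. Proof. by rewrite /ycp eqxx. Qed.

Lemma ycp_hider_strat : hider_strat n (ycp (R := R) n k h w).
Proof.
split=> [[|v] vn|]; first by rewrite ycp0.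
  by rewrite ycpE ?subr_ge0 ?cp_sum_homo //; lia.
transitivity (\sum_(v < m.+1) ycp (R := R) n k h w v).
  by have <- : n = m.+1 by lia.
rewrite big_ord_recl /= ycp0 add0r.
transitivity (cp_sum m - cp_sum 0).
  rewrite -(telescope_sumr _ (leq0n m)) big_mkord.
  by apply: eq_bigr => i _; rewrite ycpE.
have <- : cp_sum m.-1 = cp_sum m.
  by rewrite /cp_sum minnn (minn_idPr (leq_pred m)).
by rewrite -seg_end_w cp_sum_seg_end // cp_sum0 subr0 divff // pnatr_eq0; lia.
Qed.

Lemma ycp_hpayoff_le T : (2 <= k)%N -> (2 ^ k < n)%N -> in_Tk n k T ->
  hpayoff n (ycp (R := R) n k h w) T <= h%:R / w%:R.
Proof.
move=> k2 kn Tk; have hw : (h <= w)%N.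
  by rewrite -(leq_pmul2r (m := m)); [nia | lia].
rewrite -cp_sum_seg_end // seg_end_h; apply: hpayoff_le => //.
- exact: cp_sum0.
- exact: cp_sum_homo.
- exact: ycpE.
- exact: cp_sum_sub.
- exact: cp_sum_sup.
- exact: cp_sum_sym.
Qed.

End CoprimeHider.

(** * The hider strategy y^nc in the noncoprime case *)

Section NoncoprimeHider.

Variables (n k h w : nat).
Local Notation c := (cpar k).
Local Notation m := n.-1.
Local Notation d := (gcdn c m).
Hypotheses (w_gt0 : (0 < w)%N) (d_gt1 : (1 < d)%N) (n_gt : (c.+2 <= m)%N).
Hypotheses (hE : (h * d = c)%N) (wE : (w * d = m)%N).

Variable R : realFieldType.

(** [x - x %/ d] counts the vertices among [1, ..., x] that are not multiples of [d]. *)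
Definition nc_sum x : R := (x - x %/ d)%:R / (w * d.-1)%:R.

Let den_gt0 : 0 < (w * d.-1)%:R :> R.
Proof. by rewrite ltr0n muln_gt0 w_gt0 -ltnS prednK // ltnW. Qed.

Let d_gt0 : (0 < d)%N. Proof. exact: ltnW. Qed.

Let divd_le x : (x %/ d <= x)%N. Proof. exact: leq_div. Qed.

Lemma nc_sum0 : nc_sum 0 = 0.
Proof. by rewrite /nc_sum div0n mul0r. Qed.

Lemma ync_nc_sum i : ync (R := R) n k w i.+1 = nc_sum i.+1 - nc_sum i.
Proof.
rewrite /ync /nc_sum -mulrBl -natrB; last first.
  by rewrite divnS //; have := divd_le i; case: (d %| _)%N => /=; lia.
rewrite divnS // -natrM; have := divd_le i.
by case: (d %| i.+1)%N => /= le; [rewrite addnC addn1 subSS subnn mul0r |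
  rewrite add0n subSn // subSnn].
Qed.

Lemma ync0 : ync (R := R) n k w 0 = 0. Proof. by rewrite /ync dvdn0. Qed.

Lemma ync_ge0 i : 0 <= ync (R := R) n k w i.
Proof. by rewrite /ync; case: ifP => // _; rewrite divr_ge0 // mulr_ge0 // ler0n. Qed.

Lemma nc_sum_homo : {homo nc_sum : x y / (x <= y)%N >-> x <= y}.
Proof.
apply: (homo_leq (r := <=%R)) => [x|y x z|x]; [exact: lexx|exact: le_trans|].
by rewrite -subr_ge0 -ync_nc_sum ync_ge0.
Qed.

Lemma nc_sum_sub i j : nc_sum (i + j) <= nc_sum i + nc_sum j.
Proof.
rewrite /nc_sum -mulrDl ler_pM2r ?invr_gt0 // -natrD ler_nat.
have := leq_divDl d i j; have := divd_le i; have := divd_le j.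
rewrite divnD //; lia.
Qed.

(** Two remainders plus one stay below [2 * d], so the quotient exceeds the sum of the quotients by
    at most [1], which the extra vertex offsets. *)
Lemma nc_sum_sup i j : nc_sum i + nc_sum j <= nc_sum (i + j).+1.
Proof.
rewrite /nc_sum -mulrDl ler_pM2r ?invr_gt0 // -natrD ler_nat.
have : ((i + j).+1 %/ d <= (i %/ d + j %/ d).+1)%N.
  rewrite -ltnS ltn_divLR //.
  have := ltn_pmod i d_gt0; have := ltn_pmod j d_gt0.
  have := divn_eq i d; have := divn_eq j d.
  rewrite !mulSn mulnDl; move: (i %/ d * d)%N (j %/ d * d)%N (i %% d)%N (j %% d)%N; lia.
have := divd_le i; have := divd_le j; lia.
Qed.

Lemma nc_sum_m : nc_sum m = 1.
Proof.
rewrite /nc_sum -{1 2}wE mulnK //; have -> : (w * d - w = w * d.-1)%N.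
  by rewrite -[d.-1]subn1 mulnBr muln1.
by rewrite divff // gt_eqF.
Qed.

Lemma nc_sum_c : nc_sum c = h%:R / w%:R.
Proof.
rewrite /nc_sum -{1 2}hE mulnK //; have -> : (h * d - h = h * d.-1)%N.
  by rewrite -[d.-1]subn1 mulnBr muln1.
have d0 : d.-1%:R != 0 :> R by rewrite pnatr_eq0 -lt0n -ltnS prednK.
by rewrite !natrM -mulf_div divff // mulr1.
Qed.

(** As [d] divides [m], the reflection [v -> m - v] preserves the multiples of [d]. *)
Lemma nc_sum_sym i : (i < m)%N -> nc_sum i + nc_sum (m.-1 - i) = nc_sum m.
Proof.
move=> im; rewrite /nc_sum -mulrDl -natrD; congr (_%:R / _).
have lt : (i %/ d < w)%N by rewrite ltn_divLR // wE.
have E : (m.-1 - i = (w - (i %/ d).+1) * d + (d - (i %% d).+1))%N.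
  have := divn_eq i d; have := ltn_pmod i d_gt0.
  have : ((i %/ d).+1 * d <= w * d)%N by rewrite leq_mul2r lt orbT.
  rewrite mulnBl wE mulSn.
  move: (i %/ d * d)%N (i %% d)%N im; lia.
have : ((m.-1 - i) %/ d = w - (i %/ d).+1)%N.
  by rewrite E divnMDl // [X in (_ + X)%N]divn_small ?addn0 // ltn_subrL d_gt0.
have -> : (m %/ d = w)%N by rewrite -{1}wE mulnK.
have := divd_le i; have := divd_le (m.-1 - i); have := divd_le m; lia.
Qed.

Lemma ync_hider_strat : hider_strat n (ync (R := R) n k w).
Proof.
split=> [v _|]; first exact: ync_ge0.
transitivity (\sum_(v < m.+1) ync (R := R) n k w v).
  by have <- : n = m.+1 by lia.
rewrite big_ord_recl /= ync0 add0r.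
transitivity (nc_sum m - nc_sum 0); last by rewrite nc_sum0 nc_sum_m subr0.
rewrite -(telescope_sumr _ (leq0n m)) big_mkord.
by apply: eq_bigr => i _; rewrite ync_nc_sum.
Qed.

Lemma ync_hpayoff_le T : (2 <= k)%N -> (2 ^ k < n)%N -> in_Tk n k T ->
  hpayoff n (ync (R := R) n k w) T <= h%:R / w%:R.
Proof.
move=> k2 kn Tk; rewrite -nc_sum_c; apply: hpayoff_le => //.
- exact: nc_sum0.
- exact: ync0.
- exact: nc_sum_homo.
- by move=> i _; apply: ync_nc_sum.
- by move=> i j _; apply: nc_sum_sub.
- by move=> i j _; apply: nc_sum_sup.
- exact: nc_sum_sym.
Qed.

End NoncoprimeHider.

(** * Weak duality and the value of the game *)

Lemma hpayoff_payoff (R : realFieldType) n (x : seq (tree * R)) (y : nat -> R) :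
  \sum_(v < n) y v * payoff n x v = \sum_(p <- x) p.2 * hpayoff n y p.1.
Proof.
rewrite /payoff /hpayoff.
under eq_bigr do rewrite big_mkcond mulr_sumr.
rewrite exchange_big /=; apply: eq_bigr => p _.
rewrite [in RHS]big_mkcond mulr_sumr; apply: eq_bigr => v _.
by case: (covers _ _ _); rewrite ?mulr0 // mulrC.
Qed.

(** Otherwise every payoff exceeds [val] while their [y]-average is at most [val]; this forces [y]
    to vanish, against total mass [1]. *)
Lemma payoff_le_exists (R : realFieldType) n k val (x : seq (tree * R)) (y : nat -> R) :
  seeker_strat n k x -> hider_strat n y ->
  (forall T, in_Tk n k T -> hpayoff n y T <= val) ->
  exists2 v, (v < n)%N & payoff n x v <= val.
Proof.
move=> [xT x0 x1] [y0 y1] Hy.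
have [/existsP[v le]|/existsPn none] := boolP [exists v : 'I_n, payoff n x v <= val].
  by exists v.
have ub : \sum_(v < n) y v * payoff n x v <= val.
  rewrite hpayoff_payoff -[leRHS]mul1r -x1 mulr_suml.
  rewrite big_seq [leRHS]big_seq; apply: ler_sum => p px.
  by rewrite ler_wpM2l ?(allP x0) // Hy // (allP xT).
have lb (v : 'I_n) : 0 <= y v * (payoff n x v - val).
  by rewrite mulr_ge0 ?y0 // subr_ge0 ltW // ltNge none.
have s0 : \sum_(v < n) y v * (payoff n x v - val) = 0.
  apply/eqP; rewrite eq_le sumr_ge0 // andbT.
  under eq_bigr do rewrite mulrBr.
  by rewrite sumrB -mulr_suml y1 mul1r subr_le0.
have yv0 (v : 'I_n) : y v = 0.
  have /eqP : y v * (payoff n x v - val) = 0.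
    by apply: (psumr_eq0P _ s0) => // i _; apply: lb.
  by rewrite mulf_eq0 subr_eq0 [payoff _ _ _ == _]gt_eqF ?orbF ?ltNge ?none // => /eqP.
by move: y1; rewrite big1 // => /esym/eqP; rewrite oner_eq0.
Qed.

(** The dual averaging argument, with the weights of [x]. *)
Lemma hpayoff_ge_exists (R : realFieldType) n k val (x : seq (tree * R)) (y : nat -> R) :
  seeker_strat n k x -> hider_strat n y ->
  (forall v, (v < n)%N -> val <= payoff n x v) ->
  exists2 T, in_Tk n k T & val <= hpayoff n y T.
Proof.
move=> [xT x0 x1] [y0 y1] Hx.
have [/hasP[p px le]|/hasPn none] := boolP (has (fun p => val <= hpayoff n y p.1) x).
  by exists p.1; rewrite ?(allP xT).
have lb : val <= \sum_(p <- x) p.2 * hpayoff n y p.1.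
  rewrite -hpayoff_payoff -[leLHS]mul1r -y1 mulr_suml.
  by apply: ler_sum => v _; rewrite ler_wpM2l ?y0 ?Hx.
have nn (p : tree * R) : p \in x -> 0 <= p.2 * (val - hpayoff n y p.1).
  by move=> px; rewrite mulr_ge0 ?(allP x0) // subr_ge0 ltW // ltNge none.
have s0 : \sum_(p <- x | p \in x) p.2 * (val - hpayoff n y p.1) = 0.
  apply/eqP; rewrite eq_le sumr_ge0 // andbT -big_seq.
  under eq_bigr do rewrite mulrBr.
  by rewrite sumrB -mulr_suml x1 mul1r subr_le0.
move/eqP: s0; rewrite psumr_eq0 // => /allP s0.
have : \sum_(p <- x) p.2 = 0 :> R.
  rewrite big_seq big1 // => p px; have := s0 _ px; rewrite px /=.
  by rewrite mulf_eq0 subr_eq0 [val == _]gt_eqF ?orbF ?ltNge ?none // => /eqP.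
by rewrite x1 => /eqP; rewrite oner_eq0.
Qed.

Theorem theorem3p2 (R : realFieldType) (k n h w : nat) (Tv : nat -> tree) :
  (2 <= k)%N -> (2 ^ k < n)%N ->
  (0 < h)%N -> (0 < w)%N -> (w <= n - 2)%N ->
  (h * n.-1 = w * cpar k + delta k n)%N ->
  (forall h' w' : nat, (0 < h')%N -> (0 < w')%N -> (w' <= n - 2)%N ->
     (h' * n.-1 = w' * cpar k + delta k n)%N -> (w <= w')%N) ->
  (forall v : nat, (v < n)%N -> v != 1%N ->
     in_Tk n k (Tv v) /\ (forall u, covers n (Tv v) u = Tv_cover n k v u)) ->
  let val : R := h%:R / w%:R in
  [/\ (* no seeker strategy guarantees more than h/w *)
      (forall x : seq (tree * R), seeker_strat n k x ->
         exists2 v, (v < n)%N & payoff n x v <= val),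
      (* the greedy output is a seeker strategy guaranteeing h/w *)
      seeker_strat n k (greedy (R:=R) n k Tv) /\
        (forall v, (v < n)%N -> val <= payoff n (greedy (R:=R) n k Tv) v),
      (* no hider strategy guarantees less than h/w *)
      (forall y : nat -> R, hider_strat n y ->
         exists2 T, in_Tk n k T & val <= hpayoff n y T),
      (* y^nc is optimal when gcd(c, n-1) > 1 *)
      ((1 < gcdn (cpar k) n.-1)%N ->
         hider_strat n (ync (R:=R) n k w) /\
         (forall T, in_Tk n k T -> hpayoff n (ync (R:=R) n k w) T <= val))
    & (* y^cp is optimal when gcd(c, n-1) = 1 *)
      (gcdn (cpar k) n.-1 = 1%N ->
         hider_strat n (ycp (R:=R) n k h w) /\
         (forall T, in_Tk n k T -> hpayoff n (ycp (R:=R) n k h w) T <= val))].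
Proof.
move=> k2 kn h0 w0 wn hmE min TvP val.
have k4 : (4 <= 2 ^ k)%N by rewrite (leq_pexp2l (m := 2) (n1 := 2)).
have c2 : (2 <= cpar k)%N by rewrite /cpar; lia.
have cm : ((cpar k).+2 <= n.-1)%N by rewrite /cpar; lia.
have w_lt : (w < n.-1)%N by lia.
have del1 : (delta k n <= 1)%N by rewrite /delta; case: ifP.
have d0 : (0 < gcdn (cpar k) n.-1)%N by rewrite gcdn_gt0; lia.
have noncop : (1 < gcdn (cpar k) n.-1)%N ->
    (h * gcdn (cpar k) n.-1 = cpar k)%N /\ (w * gcdn (cpar k) n.-1 = n.-1)%N.
  move=> d1; have del0 : delta k n = 0%N by rewrite /delta gtn_eqF.
  apply: noncoprime_fractionE; [lia|done|lia|done|by rewrite hmE del0 addn0|].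
  by move=> h' w' h'0 w'0 w'm E; apply: (min h'); rewrite ?del0 ?addn0 //; lia.
have dvd_mul : coprime n.-1 (cpar k) -> forall q, (n.-1 %| q * cpar k)%N = (n.-1 %| q)%N.
  by move=> cop q; rewrite Gauss_dvdl.
(* If the gcd exceeds [1], dividing by it leaves [w %| q * h] with [w] coprime to [h]; otherwise
   [n.-1] would divide [q]. Both contradict [q < w]. *)
have avoid1 q : (0 < q)%N -> (q < w)%N -> ~~ (n.-1 %| q * cpar k)%N.
  move=> q0 qw; apply/negP; have [d1|d1] := ltnP 1 (gcdn (cpar k) n.-1).
    have [hE wE] := noncop d1.
    have <- : (w %| q * h)%N = (n.-1 %| q * cpar k)%N.
      by rewrite -(dvdn_pmul2r d0) -mulnA hE wE.
    have cop : coprime w h.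
      by rewrite /coprime -(eqn_pmul2r d0) muln_gcdl hE wE mul1n gcdnC eqxx.
    by rewrite Gauss_dvdl // => /(dvdn_leq q0); lia.
  have cop : coprime n.-1 (cpar k) by rewrite coprime_sym /coprime; lia.
  by rewrite dvd_mul // => /(dvdn_leq q0); lia.
(* A gcd above [1] would divide [1]; in the coprime case [q] would be a solution smaller than [w],
   against [min]. *)
have avoid0 q : (0 < q)%N -> (q < w)%N -> ~~ (n.-1 %| (q * cpar k).+1)%N.
  move=> q0 qw; apply/negP; have [d1|d1] := ltnP 1 (gcdn (cpar k) n.-1).
    move=> /(dvdn_trans (dvdn_gcdr (cpar k) n.-1)).
    by rewrite -addn1 dvdn_addr ?dvdn_mull ?dvdn_gcdl // dvdn1 gtn_eqF.
  move=> /dvdnP[h' E]; have : (w <= q)%N; last by lia.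
  apply: (min h') => //; [by case: h' E|by lia|].
  rewrite -E /delta (_ : gcdn (cpar k) n.-1 == 1%N) ?addn1 //.
  by rewrite eqn_leq d1.
have greedyP := greedy_seeker_strat k n h w (delta k n) Tv k2 kn w0 w_lt h0 del1
  hmE avoid1 avoid0 TvP R.
have greedy_ge := greedy_payoff_ge k n h w (delta k n) Tv k2 kn w0 w_lt h0 del1
  hmE avoid1 avoid0 TvP R.
have nc : (1 < gcdn (cpar k) n.-1)%N -> hider_strat n (ync (R := R) n k w) /\
    (forall T, in_Tk n k T -> hpayoff n (ync (R := R) n k w) T <= val).
  move=> d1; have [hE wE] := noncop d1; split; first exact: (ync_hider_strat n k h).
  by move=> T; apply: (ync_hpayoff_le n k h).
have cp : gcdn (cpar k) n.-1 = 1%N -> hider_strat n (ycp (R := R) n k h w) /\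
    (forall T, in_Tk n k T -> hpayoff n (ycp (R := R) n k h w) T <= val).
  move=> d1; rewrite /delta d1 /= in hmE.
  have hc : (h <= cpar k)%N.
    rewrite -(leq_pmul2r (m := n.-1)); last by lia.
    have : (w.+1 * cpar k <= n.-1 * cpar k)%N by rewrite leq_mul2r w_lt orbT.
    by rewrite hmE mulSn [(cpar k * _)%N]mulnC; lia.
  by split=> [|T]; [apply: ycp_hider_strat | apply: ycp_hpayoff_le].
split=> //.
- move=> x xP; have [d1|d1] := ltnP 1 (gcdn (cpar k) n.-1).
    by have [yP yle] := nc d1; apply: payoff_le_exists xP yP yle.
  have [yP yle] := cp ltac:(apply/eqP; rewrite eqn_leq d1 //).
  by apply: payoff_le_exists xP yP yle.
- by move=> y yP; apply: hpayoff_ge_exists greedyP yP greedy_ge.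
Qed.
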